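(* Let $P=P^X$ be a probability measure over $\mathbb{R}^k$ and fix $\theta\in\mathbb{R}^k$. Then: (i) the map $V\mapsto D_\theta(V,P)$ is upper semicontinuous on $\mathcal{P}_{k,\mathrm{tr}}$; (ii) the depth region $R_\theta(\alpha,P)=\{V\in\mathcal{P}_{k,\mathrm{tr}}: D_\theta(V,P)\geq\alpha\}$ is closed for any $\alpha\geq 0$; (iii) if $P$ is absolutely continuous with respect to the Lebesgue measure, then $V\mapsto D_\theta(V,P)$ is also lower semicontinuous, hence continuous, on $\mathcal{P}_{k,\mathrm{tr}}$.
   Context: $P=P^X$ denotes the distribution of a random $k$-vector $X$, and $\mathrm{pr}$ denotes probability under $P$. $\mathcal{P}_k$ is the set of $k\times k$ real symmetric positive definite matrices, $A^{1/2}$ is the unique square root of $A\in\mathcal{P}_k$ in $\mathcal{P}_k$, $A^{-1/2}$ is the inverse of $A^{1/2}$, and $\mathcal{P}_{k,\mathrm{tr}}=\{V\in\mathcal{P}_k:\mathrm{tr}(V)=k\}$ is the set of shape matrices. $\mathcal{S}^{m-1}$ is the unit sphere of $\mathbb{R}^m$. For $V\in\mathcal{P}_{k,\mathrm{tr}}$, let $U_{\theta,V}=V^{-1/2}(X-\theta)/\|V^{-1/2}(X-\theta)\|$ if $X\neq\theta$ and $U_{\theta,V}=0$ otherwise, and let $W_{\theta,V}=\mathrm{vec}\{U_{\theta,V}U_{\theta,V}^T-(1/k)I_k\}\in\mathbb{R}^{k^2}$, where $\mathrm{vec}$ stacks the columns of a matrix. The fixed-$\theta$ (Tyler) shape depth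 of $V$ with respect to $P$ is $$D_\theta(V,P)=\inf_{u\in\mathcal{S}^{k^2-1}}\mathrm{pr}(u^T W_{\theta,V}\geq 0).$$ Topological statements about $\mathcal{P}_{k,\mathrm{tr}}$ refer to the topology induced by the geodesic distance $d(V_a,V_b)=\|\log(V_a^{-1/2}V_bV_a^{-1/2})\|_F$, where $\log$ is the matrix logarithm and $\|A\|_F=\{\mathrm{tr}(AA^T)\}^{1/2}$. *)

(* Defs.v *)
From HB Require Import structures.
From mathcomp Require Import all_boot all_order all_algebra.
From mathcomp Require Import all_classical all_reals all_analysis.

Set Implicit Arguments.
Unset Strict Implicit.
Unset Printing Implicit Defensive.

Import Order.TTheory GRing.Theory Num.Theory.
Import numFieldNormedType.Exports.

Local Open Scope classical_set_scope.
Local Open Scope ring_scope.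

(* R^k as a measurable space is the k-fold product [k.-tuple] of R with its
   Borel sigma-algebra; the product sigma-algebra is the Borel one. *)
Notation Rtuple R k := (k.-tuple (measurableTypeR R)).

Section lebesgue_step.
Local Open Scope ereal_scope.
Variables (R : realType) (n : nat).
Variable m : {sigma_finite_measure set (Rtuple R n) -> \bar R}.

Definition tuple_cons (p : measurableTypeR R * Rtuple R n) : Rtuple R n.+1 :=
  [tuple of p.1 :: p.2].

Lemma measurable_tuple_cons : measurable_fun [set: _] tuple_cons.
Proof. exact: measurable_cons. Qed.

Definition lebesgue_step : set (Rtuple R n.+1) -> \bar R :=
  pushforward (lebesgue_measure \x m) tuple_cons.

Let lebesgue_step0 : lebesgue_step set0 = 0.
Proof. by rewrite /lebesgue_step /pushforward preimage_set0 measure0. Qed.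

Let lebesgue_step_ge0 A : 0 <= lebesgue_step A.
Proof. exact: (measure_ge0 (lebesgue_measure \x m)). Qed.

Let lebesgue_step_sigma_additive : semi_sigma_additive lebesgue_step.
Proof.
move=> F mF tF mUF; rewrite /lebesgue_step /pushforward preimage_bigcup.
have mpre (A : set (Rtuple R n.+1)) :
    measurable A -> measurable (tuple_cons @^-1` A).
  by move=> mA; rewrite -[X in measurable X]setTI; exact: measurable_tuple_cons.
apply: measure_semi_sigma_additive.
- by move=> i; exact: mpre.
- apply/trivIsetP => /= i j _ _ ij; rewrite -preimage_setI.
  by move/trivIsetP : tF => /(_ _ _ _ _ ij) ->//; rewrite preimage_set0.
- by rewrite -preimage_bigcup; exact: mpre.
Qed.

HB.instance Definition _ := isMeasure.Build _ _ _ lebesgue_step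
  lebesgue_step0 lebesgue_step_ge0 lebesgue_step_sigma_additive.

Let lebesgue_step_sigma_finite :
  sigma_finite [set: Rtuple R n.+1] lebesgue_step.
Proof.
have /sigma_finiteP[F [TF ndF Foo]] := sigma_finiteT (@lebesgue_measure R).
have /sigma_finiteP[G [TG ndG Goo]] := sigma_finiteT m.
pose g (t : Rtuple R n.+1) : Rtuple R n := [tuple of behead t].
have mhead : measurable_fun [set: Rtuple R n.+1] (@thead _ _).
  exact: measurable_tnth.
have mg : measurable_fun [set: _] g by exact: measurable_behead.
exists (fun i => (@thead _ _) @^-1` F i `&` g @^-1` G i).
  rewrite predeqE => t; split=> // _.
  have [i _ Fi] : (\bigcup_i F i) (thead t) by rewrite -TF.
  have [j _ Gj] : (\bigcup_i G i) (g t) by rewrite -TG.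
  exists (maxn i j) => //; split.
    by have /subsetPset := ndF _ _ (leq_maxl i j); apply.
  by have /subsetPset := ndG _ _ (leq_maxr i j); apply.
move=> i; have [mFi Fioo] := Foo i; have [mGi Gioo] := Goo i; split.
  apply: measurableI.
    by rewrite -[X in measurable X]setTI; exact: mhead.
  by rewrite -[X in measurable X]setTI; exact: mg.
rewrite /lebesgue_step /pushforward.
rewrite (_ : _ @^-1` _ = F i `*` G i).
  by rewrite product_measure1E// lte_mul_pinfty// ge0_fin_numE.
apply/seteqP; split=> -[x y] /=; rewrite theadE.
  by case=> ? Gy; split=> //; rewrite (_ : y = g (tuple_cons (x, y)))//;
    exact/val_inj.
by case=> ? Gy; split=> //; rewrite (_ : g _ = y)//; exact/val_inj.
Qed.

HB.instance Definition _ := Measure_isSigmaFinite.Build _ _ _ lebesgue_step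
  lebesgue_step_sigma_finite.

End lebesgue_step.

Fixpoint lebesgue_tuple (R : realType) (n : nat) :
    {sigma_finite_measure set (Rtuple R n) -> \bar R} :=
  match n with
  | 0 => \d_([tuple] : Rtuple R 0)
  | n'.+1 => lebesgue_step (lebesgue_tuple R n')
  end.

Lemma lebesgue_tuple_box (R : realType) (n : nat)
    (A : 'I_n -> set (measurableTypeR R)) : (forall i, measurable (A i)) ->
  lebesgue_tuple R n [set x | forall i, A i (tnth x i)] =
  (\prod_(i < n) lebesgue_measure (A i))%E.
Proof.
elim: n A => [|n IH] A mA.
  rewrite big_ord0 /= diracE mem_set//=.
  by case.
rewrite big_ord_recl /= -IH// -product_measure1E//.
- rewrite /lebesgue_step/= /pushforward; congr product_measure1.
  apply/seteqP; split=> [[x y] /= Axy|[x y] /= [Ax Ay] i].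
    split; first by have := Axy ord0; rewrite tnth0.
    by move=> i; have := Axy (lift ord0 i); rewrite tnthS.
  by have [j ->|->] := unliftP ord0 i; rewrite ?tnthS ?tnth0.
- rewrite (_ : [set x | _] =
      \bigcap_(i in [set: 'I_n]) ((@tnth _ _)^~ i @^-1` A (lift ord0 i))).
    apply: fin_bigcap_measurable => // i _.
    by rewrite -[X in measurable X]setTI; exact: measurable_tnth.
  by apply/seteqP; split=> x /= h i; [move=> _; exact: h|exact: h].
Qed.

Section matrices.
Variable R : realType.

Definition frobenius_norm m n (A : 'M[R]_(m, n)) : R :=
  Num.sqrt (\tr (A *m A^T)).

(* Euclidean norm; [`| _ |] on matrices is the sup norm in the library. *)
Definition euclidean_norm m (v : 'cV[R]_m) : R :=
  Num.sqrt (\sum_(i < m) v i ord0 ^+ 2).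

Definition unit_sphere m : set 'cV[R]_m := [set u | euclidean_norm u = 1].

Definition spd k : set 'M[R]_k :=
  [set V | V^T = V /\
           forall x : 'cV[R]_k, x != 0 -> 0 < (x^T *m V *m x) ord0 ord0].

(* [xget] picks the (unique, for [V] in [spd]) element of the set. *)
Definition sqrtmx k (V : 'M[R]_k) : 'M[R]_k :=
  xget 0 [set B | spd B /\ B *m B = V].

Definition invsqrtmx k (V : 'M[R]_k) : 'M[R]_k := invmx (sqrtmx V).

(* Logarithm of a symmetric positive definite matrix by spectral calculus:
   log (Q diag(d) Q^T) = Q diag(ln d) Q^T, which does not depend on the
   orthogonal diagonalization chosen. *)
Definition logmx k (A : 'M[R]_k) : 'M[R]_k :=
  xget 0 [set L | exists (Q : 'M[R]_k) (d : 'rV[R]_k),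
    [/\ Q *m Q^T = 1%:M, forall i, 0 < d ord0 i,
        A = Q *m diag_mx d *m Q^T &
        L = Q *m diag_mx (map_mx (@ln R) d) *m Q^T]].

Definition geodesic_dist k (Va Vb : 'M[R]_k) : R :=
  frobenius_norm (logmx (invsqrtmx Va *m Vb *m invsqrtmx Va)).

Definition shape_set k : set 'M[R]_k := [set V | spd V /\ \tr V = k%:R].

(* [mxvec] stacks rows. *)
Definition vec_cols m n (A : 'M[R]_(m, n)) : 'cV[R]_(n * m) := (mxvec A^T)^T.

End matrices.

(* A separate record rather than [set_type (shape_set R k)], which already
   carries the topology induced by the norm on matrices. *)
Record shapeMx (R : realType) (k : nat) :=
  Shape { shape_mx :> 'M[R]_k ; _ : shape_mx \in @shape_set R k }.

HB.instance Definition _ (R : realType) (k : nat) :=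
  [isSub for @shape_mx R k].
HB.instance Definition _ (R : realType) (k : nat) :=
  [Choice of shapeMx R k by <:].

Section shape_topology.
Variables (R : realType) (k : nat).

Definition geodesic_open : set_system (shapeMx R k) :=
  [set O | forall V : shapeMx R k, O V -> exists2 e : R, 0 < e &
    forall V' : shapeMx R k, geodesic_dist V V' < e -> O V'].

Let geodesic_openT : geodesic_open setT.
Proof. by move=> V _; exists 1. Qed.

Let geodesic_openI : setI_closed geodesic_open.
Proof.
move=> A B oA oB V [/oA[e e0 Ae] /oB[f f0 Bf]].
exists (Num.min e f); first by rewrite lt_min e0 f0.
by move=> V'; rewrite lt_min => /andP[/Ae AV' /Bf BV'].
Qed.

Let geodesic_open_bigU (I : Type) (f : I -> set (shapeMx R k)) :
  (forall i, geodesic_open (f i)) -> geodesic_open (\bigcup_i f i).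
Proof.
move=> fo V [i _ /fo[e e0 fe]]; exists e => // V' /fe fV'.
by exists i.
Qed.

HB.instance Definition _ := isOpenTopological.Build (shapeMx R k)
  geodesic_openT geodesic_openI geodesic_open_bigU.

End shape_topology.

Section depth.
Variables (R : realType) (k : nat).
Implicit Types (theta : 'cV[R]_k) (V : 'M[R]_k) (x : Rtuple R k).

Definition tuple_col x : 'cV[R]_k := \col_i tnth x i.

Definition sign_vec theta V x : 'cV[R]_k :=
  if tuple_col x == theta then 0
  else let z := invsqrtmx V *m (tuple_col x - theta) in
       (euclidean_norm z)^-1 *: z.

Definition sign_shape theta V x : 'cV[R]_(k * k) :=
  let U := sign_vec theta V x in vec_cols (U *m U^T - k%:R^-1 *: 1%:M).

Definition shape_depth theta V (P : probability (Rtuple R k) R) : \bar R :=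
  ereal_inf [set P [set x | 0 <= (u^T *m sign_shape theta V x) ord0 ord0]
            | u in @unit_sphere R (k * k)].

Definition depth_region theta (alpha : R) (P : probability (Rtuple R k) R) :
    set (shapeMx R k) :=
  [set V | (alpha%:E <= shape_depth theta V P)%E].

End depth.

(* The counterpart of the library's [lower_semicontinuous]. *)
Definition upper_semicontinuous (X : topologicalType) (R : numFieldType)
    (f : X -> \bar R) : Prop :=
  forall x a, (f x < a%:E)%E ->
    exists2 V, nbhs x V & forall y, V y -> (f y < a%:E)%E.

(* Main.v *)
Require Import Defs.
From HB Require Import structures.
From mathcomp Require Import all_boot all_order all_algebra.
From mathcomp Require Import complex spectral finmap.
From mathcomp Require Import all_classical all_reals all_analysis.
From mathcomp Require Import measurable_realfun ring lra.

(** Upper semicontinuity needs no assumption on [P] because the sign vector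
    [sign_vec theta V x] depends continuously on [V] uniformly in [x] and
    [theta].  Indeed, with [B = sqrtmx V], [C = sqrtmx V'] and
    [z' = C^-1 (x - theta)], one has [B^-1 (x - theta) - z' = B^-1 (C - B) z'],
    so the two normalized vectors differ by at most
    [2 * |B^-1| * |C - B|], whatever [x] is ([sign_vec_continuous]).  Here
    [|C - B|] is controlled by [|V' - V|] because the square root is Lipschitz
    near a positive definite matrix ([sqrtmx_lipschitz]), and [|V' - V|] is
    controlled by the geodesic distance ([geodesic_dist_small]); both rest on
    the diagonalization of real symmetric matrices
    ([symmetric_diagonalization]).  Hence all linear functionals
    [u^T sign_shape theta V x] with [u] on the unit sphere vary by at most any
    prescribed [e > 0], uniformly in [u] and [x], when [V] moves by a small
    geodesic distance ([shape_score_continuous]).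

    Write [W_V] for [sign_shape theta V x].  If the depth of [V] is less than
    [a], some [u] satisfies [P (u^T W_V >= 0) < a], hence, by continuity from
    above, [P (u^T W_V >= - e) < a] for some [e > 0]; the latter event contains
    [u^T W_V' >= 0] for all [V'] near [V].  This gives the upper
    semicontinuity, and the closedness of the depth regions is a restatement
    of it.

    For the lower semicontinuity, write [u] as the vectorization of a matrix
    [A].  Outside [x = theta], only the symmetric traceless part of [A] matters
    ([shape_score_deviator]); if it vanishes the probability is [1], and
    otherwise it can be normalized, so that [A] ranges over the compact set of
    symmetric traceless matrices of unit norm.  For such an [A] the event
    [u^T W_V = 0] is the zero set of a nonzero quadratic polynomial in [x],
    which is Lebesgue negligible ([polyfun_zero_null]), so that
    [P (u^T W_V > 0) = P (u^T W_V >= 0)] exceeds any [a] below the depth of [V].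
    By continuity from below and compactness there is a single [e > 0] such
    that [P (u^T W_V > e) > a] for all these [A]; and [u^T W_V > e] implies
    [u^T W_V' >= 0] for all [V'] near [V]. *)

Set Implicit Arguments.
Unset Strict Implicit.
Unset Printing Implicit Defensive.

Import Order.TTheory GRing.Theory Num.Theory.
Import numFieldNormedType.Exports.

Local Open Scope classical_set_scope.
Local Open Scope ring_scope.

(** * Diagonalization of real symmetric matrices *)

(** A real symmetric matrix, seen as a complex one, is Hermitian, so that its
    complex eigenvalues are real; they are roots of the characteristic
    polynomial, which has real coefficients. *)
Lemma symmetric_eigenvector (R : rcfType) n (A : 'M[R]_n.+1) : A^T = A ->
  exists (a : R) (v : 'rV[R]_n.+1), v != 0 /\ v *m A = a *: v.
Proof.
move=> symA; pose AC : 'M[R[i]]_n.+1 := map_mx (real_complex R) A.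
have realAC : AC \is a realmx.
  by apply/mxOverP => i j; rewrite mxE; apply/complex_realP; exists (A i j).
have hermAC : AC \is hermsymmx.
  apply: realsym_hermsym => //; apply/is_hermitianmxP.
  by apply/matrixP => i j; rewrite expr0 scale1r !mxE -{1}symA mxE.
have /orthomx_spectralP spAC := hermitian_normalmx hermAC.
have /mxOverP/(_ ord0 ord0)/complex_realP[a aE] :=
  hermitian_spectral_diag_real hermAC.
have eigAC : eigenvalue AC (real_complex R a).
  apply/eigenvalueP; exists (row ord0 (spectralmx AC)).
    rewrite -row_mul [X in _ *m X]spAC !mulmxA mulmxV ?spectral_unit// mul1mx.
    by rewrite row_mul row_diag_mx -scalemxAl -rowE aE.
  apply/negP => /eqP r0; have := spectral_unit AC.
  rewrite -row_free_unit => /row_freeP[B PB].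
  have /matrixP/(_ ord0 ord0) : row ord0 (1%:M : 'M[R[i]]_n.+1) = 0.
    by rewrite -PB row_mul r0 mul0mx.
  by rewrite !mxE eqxx/= => /eqP; rewrite oner_eq0.
have : eigenvalue A a.
  move: eigAC; rewrite !eigenvalue_root_char /AC.
  by rewrite -map_char_poly fmorph_root.
by move=> /eigenvalueP[v vA v0]; exists a, v.
Qed.

Lemma trmx11 (R : Type) (A : 'M[R]_1) : A^T = A.
Proof. by apply/matrixP => i j; rewrite !mxE !ord1. Qed.

Lemma mulmx_trC (R : comPzRingType) n (v w : 'rV[R]_n) : v *m w^T = w *m v^T.
Proof. by rewrite -[LHS]trmx11 trmx_mul trmxK. Qed.

Lemma row_norm_gt0 (R : realDomainType) n (v : 'rV[R]_n) :
  v != 0 -> 0 < (v *m v^T) 0 0.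
Proof.
move=> v0; rewrite lt_def; apply/andP; split; last first.
  by rewrite mxE; apply: sumr_ge0 => j _; rewrite mxE -expr2 sqr_ge0.
apply: contra v0; rewrite mxE => /eqP/psumr_eq0P vj.
apply/eqP/rowP => j; rewrite !mxE.
have := vj (fun j _ => _) j isT; rewrite mxE -expr2 => /(_ _)/eqP.
rewrite sqrf_eq0 => H; apply/eqP/H => i.
by rewrite mxE -expr2 sqr_ge0.
Qed.

(** The reflection that exchanges [v] and the first basis vector [e]; its
    normal direction is [v - e] (the identity if [v = e]). *)
Lemma householder (R : realFieldType) n (v : 'rV[R]_n.+1) : v *m v^T = 1%:M ->
  exists2 H : 'M[R]_n.+1, H *m H^T = 1%:M & delta_mx 0 0 *m H = v.
Proof.
move=> v1; pose e : 'rV[R]_n.+1 := delta_mx 0 0; pose w := v - e.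
have e1 : e *m e^T = 1%:M.
  by rewrite /e -rowE; apply/matrixP => i j; rewrite !mxE !ord1.
have [w0|w0] := eqVneq w 0.
  exists 1%:M; rewrite ?trmx1 ?mulmx1//.
  by apply/eqP; rewrite eq_sym -subr_eq0 -/e -/w w0.
pose s : R := (w *m w^T) 0 0.
have ws : w *m w^T = s%:M by rewrite [LHS]mx11_scalar.
have s0 : s != 0 by rewrite gt_eqF// row_norm_gt0.
have ew : e *m w^T = (- (s / 2))%:M.
  pose c := (e *m v^T) 0 0.
  have ec : e *m v^T = c%:M by rewrite [LHS]mx11_scalar.
  have sE : s = 2 - 2 * c.
    rewrite /s /w linearB/= mulmxBr !mulmxBl v1 e1 (mulmx_trC v e) ec.
    by rewrite !mxE eqxx /= !mulr1n; ring.
  rewrite linearB/= mulmxBr e1 ec -raddfB/= sE; congr _%:M.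
  by field.
exists (1%:M - (2 / s) *: (w^T *m w)).
  have -> : (1%:M - (2 / s) *: (w^T *m w))^T = 1%:M - (2 / s) *: (w^T *m w).
    by rewrite [LHS]linearB/= [_^T in X in _ - X]linearZ/= trmx_mul trmxK trmx1.
  rewrite mulmxBr mulmx1 mulmxBl mul1mx -scalemxAl -scalemxAr.
  rewrite mulmxA -(mulmxA w^T) ws mul_mx_scalar -scalemxAl !scalerA -scalerBl.
  have -> : 2 / s - 2 / s * (2 / s * s) = - (2 / s) by field.
  by rewrite scaleNr opprK subrK.
rewrite mulmxBr mulmx1 -scalemxAr mulmxA ew mul_scalar_mx scalerA.
have -> : 2 / s * - (s / 2) = -1 by field.
by rewrite scaleN1r opprK /w addrC subrK.
Qed.

(** Conjugating [A] by an orthogonal matrix whose first row is a unit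
    eigenvector splits off a diagonal block of size one. *)
Lemma symmetric_diagonalization (R : rcfType) n (A : 'M[R]_n) : A^T = A ->
  exists (Q : 'M[R]_n) (d : 'rV[R]_n),
    Q *m Q^T = 1%:M /\ A = Q *m diag_mx d *m Q^T.
Proof.
elim: n A => [|n IH] A symA.
  by exists 1%:M, 0; split; apply/matrixP; case.
have [a [v [v0 vA]]] := symmetric_eigenvector symA.
pose r := Num.sqrt ((v *m v^T) 0 0).
have r2 : (v *m v^T) 0 0 = r ^+ 2 by rewrite sqr_sqrtr// ltW// row_norm_gt0.
have r0 : r != 0.
  have := row_norm_gt0 v0; rewrite r2; apply: contraTneq => ->.
  by rewrite expr0n ltxx.
have [|H H1 eH] := @householder R n (r^-1 *: v).
  rewrite linearZ/= -scalemxAl -scalemxAr scalerA [v *m _]mx11_scalar r2.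
  by rewrite scale_scalar_mx; congr _%:M; field.
have HT1 : H^T *m H = 1%:M by apply: mulmx1C.
have eB : (delta_mx 0 0 : 'rV[R]_n.+1) *m (H *m A *m H^T) = a *: delta_mx 0 0.
  rewrite !mulmxA eH -scalemxAl vA -!scalemxAl scalerA mulrC -scalerA.
  by rewrite scalemxAl -eH -mulmxA H1 mulmx1.
have symB : (H *m A *m H^T)^T = H *m A *m H^T.
  by rewrite !trmx_mul trmxK symA mulmxA.
have [B BE] : exists B, B = H *m A *m H^T by exists (H *m A *m H^T).
rewrite -BE in eB symB.
have B0 (i j : 'I_n.+1) : i = 0 :> nat -> B i j = a *+ (j == 0 :> nat).
  move=> i0; have -> : i = 0 by exact/val_inj.
  by have /rowP/(_ j) := eB; rewrite -rowE !mxE eqxx/= mulr_natr.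
have [Q [d [Q1 QE]]] := IH (drsubmx (B : 'M[R]_(1 + n)))
  (etrans (trmx_drsub _) (congr1 _ symB)).
pose Q' : 'M[R]_(1 + n) := block_mx 1%:M 0 0 Q.
have BQ : B = Q' *m diag_mx (row_mx a%:M d) *m Q'^T :> 'M[R]_(1 + n).
  rewrite diag_mx_row tr_block_mx !mulmx_block !trmx0 trmx1.
  rewrite !(mulmx0, mul0mx, mulmx1, mul1mx, addr0, add0r) -QE.
  rewrite -[LHS](@submxK _ 1 n 1 n); congr block_mx.
  - apply/matrixP => i j; rewrite (ord1 i) (ord1 j) !mxE eqxx.
    exact: (B0 (lshift n (0 : 'I_1)) (lshift n (0 : 'I_1))).
  - apply/matrixP => i j; rewrite (ord1 i) !mxE.
    exact: (B0 (lshift n (0 : 'I_1)) (rshift 1 j)).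
  - apply/matrixP => i j; rewrite (ord1 j) -symB !mxE.
    exact: (B0 (lshift n (0 : 'I_1)) (rshift 1 i)).
exists (H^T *m (Q' : 'M[R]_n.+1)), (row_mx a%:M d); split.
  rewrite trmx_mul trmxK mulmxA -(mulmxA H^T).
  have -> : Q' *m Q'^T = 1%:M.
    rewrite tr_block_mx mulmx_block !trmx0 trmx1.
    rewrite !(mulmx0, mul0mx, mulmx1, mul1mx, addr0, add0r) Q1.
    by rewrite -scalar_mx_block.
  by rewrite mulmx1.
rewrite trmx_mul trmxK -[LHS]mul1mx -[LHS]mulmx1 -HT1.
by rewrite -!mulmxA (mulmxA A) (mulmxA H) (mulmxA H A) -BE BQ !mulmxA.
Qed.

(** * The Frobenius norm *)

Section frobenius.
Variable R : realType.
Implicit Types m n p : nat.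

Lemma mxtrace_mul_tr m n (A B : 'M[R]_(m, n)) :
  \tr (A *m B^T) = \sum_i \sum_j A i j * B i j.
Proof.
by apply: eq_bigr => i _; rewrite mxE; apply: eq_bigr => j _; rewrite mxE.
Qed.

Lemma frobenius_norm_sqr m n (A : 'M[R]_(m, n)) :
  frobenius_norm A ^+ 2 = \tr (A *m A^T).
Proof.
rewrite sqr_sqrtr// mxtrace_mul_tr.
by apply: sumr_ge0 => i _; apply: sumr_ge0 => j _; rewrite -expr2 sqr_ge0.
Qed.

Lemma frobenius_norm_sqr_sum m n (A : 'M[R]_(m, n)) :
  frobenius_norm A ^+ 2 = \sum_i \sum_j A i j ^+ 2.
Proof. by rewrite frobenius_norm_sqr mxtrace_mul_tr. Qed.

Lemma frobenius_norm_ge0 m n (A : 'M[R]_(m, n)) : 0 <= frobenius_norm A.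
Proof. exact: sqrtr_ge0. Qed.

Lemma frobenius_norm0_eq m n (A : 'M[R]_(m, n)) : frobenius_norm A = 0 -> A = 0.
Proof.
move=> A0; apply/matrixP => i j; rewrite mxE.
have /eqP := frobenius_norm_sqr_sum A; rewrite A0 expr0n/= eq_sym.
rewrite psumr_eq0; last first.
  by move=> i' _; apply: sumr_ge0 => j' _; rewrite sqr_ge0.
move=> /allP/(_ i); rewrite mem_index_enum => /(_ isT).
rewrite psumr_eq0; last by move=> j' _; rewrite sqr_ge0.
move=> /allP/(_ j); rewrite mem_index_enum => /(_ isT).
by rewrite sqrf_eq0 => /eqP.
Qed.

Lemma frobenius_norm0 m n : frobenius_norm (0 : 'M[R]_(m, n)) = 0.
Proof. by rewrite /frobenius_norm mul0mx mxtrace0 sqrtr0. Qed.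

Lemma frobenius_norm_gt0 m n (A : 'M[R]_(m, n)) :
  A != 0 -> 0 < frobenius_norm A.
Proof.
move=> A0; rewrite lt_def frobenius_norm_ge0 andbT.
by apply: contra A0 => /eqP/frobenius_norm0_eq ->.
Qed.

Lemma frobenius_normZ m n (a : R) (A : 'M[R]_(m, n)) :
  frobenius_norm (a *: A) = `|a| * frobenius_norm A.
Proof.
apply/eqP; rewrite -(@eqrXn2 _ 2)// ?mulr_ge0 ?frobenius_norm_ge0//.
rewrite exprMn real_normK ?num_real// !frobenius_norm_sqr_sum mulr_sumr.
apply/eqP/eq_bigr => i _; rewrite mulr_sumr; apply: eq_bigr => j _.
by rewrite mxE exprMn.
Qed.

Lemma frobenius_normN m n (A : 'M[R]_(m, n)) :
  frobenius_norm (- A) = frobenius_norm A.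
Proof. by rewrite -scaleN1r frobenius_normZ normrN1 mul1r. Qed.

Lemma frobenius_norm_tr m n (A : 'M[R]_(m, n)) :
  frobenius_norm A^T = frobenius_norm A.
Proof. by rewrite /frobenius_norm trmxK mxtrace_mulC. Qed.

Lemma frobenius_cauchy_schwarz m n (A B : 'M[R]_(m, n)) :
  \tr (A *m B^T) <= frobenius_norm A * frobenius_norm B.
Proof.
have [/frobenius_norm0_eq ->|A0] := eqVneq (frobenius_norm A) 0.
  by rewrite mul0mx mxtrace0 mulr_ge0 ?frobenius_norm_ge0.
have [/frobenius_norm0_eq ->|B0] := eqVneq (frobenius_norm B) 0.
  by rewrite trmx0 mulmx0 mxtrace0 mulr_ge0 ?frobenius_norm_ge0.
have {}A0 : 0 < frobenius_norm A by rewrite lt_def A0 frobenius_norm_ge0.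
have {}B0 : 0 < frobenius_norm B by rewrite lt_def B0 frobenius_norm_ge0.
set a := frobenius_norm A in A0 *; set b := frobenius_norm B in B0 *.
have := sqr_ge0 (frobenius_norm (b *: A - a *: B)).
have -> : frobenius_norm (b *: A - a *: B) ^+ 2 =
    b ^+ 2 * \tr (A *m A^T) + a ^+ 2 * \tr (B *m B^T)
    - (2 * (a * b)) * \tr (A *m B^T).
  rewrite frobenius_norm_sqr !mxtrace_mul_tr !mulr_sumr -big_split/= -sumrB.
  apply: eq_bigr => i _; rewrite !mulr_sumr -big_split/= -sumrB.
  by apply: eq_bigr => j _; rewrite !mxE; ring.
rewrite -!frobenius_norm_sqr -/a -/b.
have -> : b ^+ 2 * a ^+ 2 + a ^+ 2 * b ^+ 2 = (2 * (a * b)) * (a * b) by ring.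
by rewrite -mulrBr pmulr_rge0 ?mulr_gt0// subr_ge0.
Qed.

Lemma frobenius_cauchy_schwarz_abs m n (A B : 'M[R]_(m, n)) :
  `|\tr (A *m B^T)| <= frobenius_norm A * frobenius_norm B.
Proof.
rewrite ler_norml frobenius_cauchy_schwarz andbT lerNl.
rewrite -[frobenius_norm A]frobenius_normN.
have -> : - \tr (A *m B^T) = \tr (- A *m B^T) by rewrite mulNmx raddfN.
exact: frobenius_cauchy_schwarz.
Qed.

Lemma frobenius_normD m n (A B : 'M[R]_(m, n)) :
  frobenius_norm (A + B) <= frobenius_norm A + frobenius_norm B.
Proof.
rewrite -(@ler_pXn2r _ 2)// ?nnegrE ?addr_ge0 ?frobenius_norm_ge0//.
rewrite sqrrD !frobenius_norm_sqr linearD/= mulmxDl !mulmxDr !raddfD/=.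
have -> : \tr (B *m A^T) = \tr (A *m B^T).
  by rewrite -mxtrace_tr trmx_mul trmxK.
have := frobenius_cauchy_schwarz A B; lra.
Qed.

Lemma frobenius_normM m n p (A : 'M[R]_(m, n)) (B : 'M[R]_(n, p)) :
  frobenius_norm (A *m B) <= frobenius_norm A * frobenius_norm B.
Proof.
rewrite -(@ler_pXn2r _ 2)// ?nnegrE ?mulr_ge0 ?frobenius_norm_ge0//.
rewrite exprMn -[frobenius_norm B]frobenius_norm_tr !frobenius_norm_sqr_sum.
rewrite mulr_suml; apply: ler_sum => i _; rewrite mulr_sumr.
apply: ler_sum => j _.
pose a : 'rV[R]_n := row i A; pose b : 'rV[R]_n := (col j B)^T.
have -> : (A *m B) i j = \tr (a *m b^T).
  rewrite mxtrace_mul_tr big_ord1 mxE.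
  by apply: eq_bigr => k _; rewrite !mxE.
have -> : \sum_j A i j ^+ 2 = frobenius_norm a ^+ 2.
  rewrite frobenius_norm_sqr_sum big_ord1.
  by apply: eq_bigr => k _; rewrite !mxE.
have -> : \sum_k B^T j k ^+ 2 = frobenius_norm b ^+ 2.
  rewrite frobenius_norm_sqr_sum big_ord1.
  by apply: eq_bigr => k _; rewrite !mxE.
rewrite -exprMn -[leLHS]real_normK ?num_real//.
by rewrite ler_pXn2r ?nnegrE ?mulr_ge0 ?frobenius_norm_ge0//
  frobenius_cauchy_schwarz_abs.
Qed.

Lemma frobenius_norm_orthogonal_l m n (Q : 'M[R]_m) (A : 'M[R]_(m, n)) :
  Q *m Q^T = 1%:M -> frobenius_norm (Q *m A) = frobenius_norm A.
Proof.
move=> /mulmx1C Q1; rewrite /frobenius_norm trmx_mul mxtrace_mulC.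
by rewrite mulmxA -(mulmxA _ _ Q) Q1 mulmx1 mxtrace_mulC.
Qed.

Lemma frobenius_norm_orthogonal_r m n (Q : 'M[R]_n) (A : 'M[R]_(m, n)) :
  Q *m Q^T = 1%:M -> frobenius_norm (A *m Q) = frobenius_norm A.
Proof.
by move=> Q1; rewrite /frobenius_norm trmx_mul mulmxA -(mulmxA A) Q1 mulmx1.
Qed.

Lemma frobenius_norm_diag n (d : 'rV[R]_n) :
  frobenius_norm (diag_mx d) ^+ 2 = \sum_i d 0 i ^+ 2.
Proof.
rewrite frobenius_norm_sqr_sum; apply: eq_bigr => i _.
rewrite (bigD1 i)//= mxE eqxx mulr1n big1 ?addr0// => j ij.
by rewrite mxE eq_sym (negbTE ij) mulr0n expr0n.
Qed.

Lemma euclidean_normE m (v : 'cV[R]_m) : euclidean_norm v = frobenius_norm v.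
Proof.
rewrite /euclidean_norm /frobenius_norm mxtrace_mul_tr.
by congr Num.sqrt; apply: eq_bigr => i _; rewrite big_ord1 expr2.
Qed.

End frobenius.

(** * Positive definite matrices and the geodesic distance *)

Section spd.
Variable R : realType.
Implicit Types m n k : nat.

(** The trace form of a diagonalized matrix; with [D] a row vector, it is the
    value of the quadratic form at [D]. *)
Lemma mxtrace_conj_diag m n (D : 'M[R]_(m, n)) (Q : 'M[R]_n) (d : 'rV[R]_n) :
  \tr (D *m (Q *m diag_mx d *m Q^T) *m D^T) =
  \sum_i \sum_j d 0 j * (D *m Q) i j ^+ 2.
Proof.
have -> : D *m (Q *m diag_mx d *m Q^T) *m D^T =
    (D *m Q *m diag_mx d) *m (D *m Q)^T by rewrite trmx_mul !mulmxA.
rewrite mxtrace_mul_tr; apply: eq_bigr => i _; apply: eq_bigr => j _.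
by rewrite mul_mx_diag mxE; ring.
Qed.

Lemma conj_diag_col k (Q : 'M[R]_k) (d : 'rV[R]_k) i : Q *m Q^T = 1%:M ->
  ((col i Q)^T *m (Q *m diag_mx d *m Q^T) *m col i Q) 0 0 = d 0 i.
Proof.
move=> /mulmx1C Q1; rewrite colE trmx_mul -!mulmxA (mulmxA Q^T Q) Q1 mul1mx.
rewrite (mulmxA Q^T Q) Q1 mul1mx trmx_delta -rowE mxE.
by rewrite mul_diag_mx !mxE !eqxx mulr1.
Qed.

Lemma spd_diagonalization k (V : 'M[R]_k) : spd V ->
  exists (Q : 'M[R]_k) (d : 'rV[R]_k),
    [/\ Q *m Q^T = 1%:M, forall i, 0 < d 0 i & V = Q *m diag_mx d *m Q^T].
Proof.
move=> [symV posV]; have [Q [d [Q1 VE]]] := symmetric_diagonalization symV.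
exists Q, d; split=> // i; have Q1' := mulmx1C Q1.
rewrite -(conj_diag_col d i Q1) -VE.
apply: posV; apply: contraTneq isT => Qi0.
have /matrixP/(_ i i) := Q1'.
rewrite !mxE eqxx big1 => [/esym/eqP|j _]; first by rewrite oner_eq0.
by move/colP/(_ j) : Qi0; rewrite !mxE => ->; rewrite mul0r.
Qed.

Lemma spd_conj_diag k (Q : 'M[R]_k) (d : 'rV[R]_k) :
  Q *m Q^T = 1%:M -> (forall i, 0 < d 0 i) -> spd (Q *m diag_mx d *m Q^T).
Proof.
move=> Q1 d0; split; first by rewrite !trmx_mul trmxK tr_diag_mx mulmxA.
move=> x x0; rewrite -[_ 0 0]trace_mx11 -{2}[x]trmxK.
rewrite mxtrace_conj_diag big_ord1.
have ge0 j : 0 <= d 0 j * (x^T *m Q) 0 j ^+ 2.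
  by rewrite mulr_ge0 ?sqr_ge0// ltW.
rewrite lt_def sumr_ge0// andbT; apply: contra x0 => /eqP/psumr_eq0P s0.
apply/eqP; rewrite -[x]trmxK -[x^T]mulmx1 -Q1 mulmxA.
have -> : x^T *m Q = 0; last by rewrite mul0mx trmx0.
apply/rowP => j; have /eqP := s0 (fun i _ => ge0 i) j isT.
by rewrite mulf_eq0 gt_eqF//= sqrf_eq0 [RHS]mxE => /eqP.
Qed.

Lemma spd_unitmx k (V : 'M[R]_k) : spd V -> V \in unitmx.
Proof.
move=> /spd_diagonalization[Q [d [Q1 d0 ->]]].
have [uQ uQT] := mulmx1_unit Q1.
rewrite !unitmx_mul uQ uQT andbT/= unitmxE det_diag unitfE.
by apply/prodf_neq0 => i _; rewrite gt_eqF.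
Qed.

(** The constant is the least eigenvalue of [B], truncated at [1] so that it is
    defined in dimension [0] as well. *)
Lemma spd_coercive k (B : 'M[R]_k) : spd B ->
  exists2 l : R, 0 < l & forall m (D : 'M[R]_(m, k)),
    l * frobenius_norm D ^+ 2 <= \tr (D *m B *m D^T).
Proof.
move=> /spd_diagonalization[Q [d [Q1 d0 ->]]].
exists (\big[Num.min/1]_i d 0 i).
  by apply: lt_bigmin => // i _.
move=> m D; rewrite mxtrace_conj_diag -(frobenius_norm_orthogonal_r D Q1).
rewrite frobenius_norm_sqr_sum mulr_sumr; apply: ler_sum => i _.
rewrite mulr_sumr; apply: ler_sum => j _.
by rewrite ler_wpM2r ?sqr_ge0// bigmin_le.
Qed.

Lemma mxtrace_conj_spd_ge0 k m (B : 'M[R]_k) (D : 'M[R]_(m, k)) : spd B ->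
  0 <= \tr (D *m B *m D^T).
Proof.
move=> /spd_coercive[l l0 /(_ _ D)]; apply: le_trans.
by rewrite mulr_ge0 ?sqr_ge0// ltW.
Qed.

Lemma sqrtmxP k (V : 'M[R]_k) : spd V ->
  spd (sqrtmx V) /\ sqrtmx V *m sqrtmx V = V.
Proof.
move=> /spd_diagonalization[Q [d [Q1 d0 VE]]].
apply: (@xgetPex _ 0 [set B | spd B /\ B *m B = V]).
exists (Q *m diag_mx (map_mx Num.sqrt d) *m Q^T); split.
  by apply: spd_conj_diag => // i; rewrite mxE sqrtr_gt0.
rewrite -!mulmxA (mulmxA Q^T Q) (mulmx1C Q1) mul1mx VE !mulmxA.
congr (_ *m _); rewrite -mulmxA mulmx_diag; congr (_ *m diag_mx _).
by apply/rowP => i; rewrite !mxE -expr2 sqr_sqrtr// ltW.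
Qed.

Lemma invsqrtmx_spd k (V : 'M[R]_k) : spd V ->
  [/\ invsqrtmx V *m sqrtmx V = 1%:M, sqrtmx V *m invsqrtmx V = 1%:M &
      (invsqrtmx V)^T = invsqrtmx V].
Proof.
move=> /sqrtmxP[sB _]; have uB := spd_unitmx sB; rewrite /invsqrtmx.
by rewrite mulVmx// mulmxV// trmx_inv (proj1 sB).
Qed.

(** The square root is Lipschitz near a positive definite matrix: if
    [B = sqrtmx V], [C = sqrtmx V'] and [D = C - B], then
    [V' - V = D *m B + C *m D], and pairing with [D] gives a lower bound. *)
Lemma sqrtmx_lipschitz k (V : 'M[R]_k) : spd V ->
  exists2 c : R, 0 < c & forall V', spd V' ->
    frobenius_norm (sqrtmx V' - sqrtmx V) <= c * frobenius_norm (V' - V).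
Proof.
move=> /sqrtmxP[sB BV]; have [l l0 lB] := spd_coercive sB.
exists l^-1; rewrite ?invr_gt0// => V' /sqrtmxP[sC CV].
set B := sqrtmx V in sB BV lB *; set C := sqrtmx V' in sC CV *.
set D := C - B; set d := frobenius_norm D.
have VD : V' - V = D *m B + C *m D.
  by rewrite /D mulmxBl mulmxBr BV CV [RHS]addrC addrA subrK.
have trE : \tr ((V' - V) *m D^T) =
    \tr (D *m B *m D^T) + \tr (D^T *m C *m D^T^T).
  rewrite VD mulmxDl mxtraceD; congr (_ + _).
  by rewrite trmxK -[RHS]mxtrace_mulC mulmxA mxtrace_mulC mulmxA.
have : l * d ^+ 2 <= frobenius_norm (V' - V) * d.
  apply: le_trans (frobenius_cauchy_schwarz _ _); rewrite trE.
  by rewrite -[leLHS]addr0 lerD ?lB ?mxtrace_conj_spd_ge0.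
have [->|d0] := eqVneq d 0.
  by rewrite mulr_ge0 ?frobenius_norm_ge0// invr_ge0 ltW.
have {}d0 : 0 < d by rewrite lt_def d0 frobenius_norm_ge0.
by rewrite expr2 mulrA ler_pM2r// mulrC -ler_pdivlMr// mulrC.
Qed.

(** Matrices close to [V] in geodesic distance are close in norm. *)
Lemma geodesic_dist_small k (V : 'M[R]_k) (e : R) : spd V -> 0 < e ->
  exists2 r : R, 0 < r & forall V', spd V' -> geodesic_dist V V' < r ->
    frobenius_norm (V' - V) <= e.
Proof.
move=> sV e0; have [BiB BBi BiT] := invsqrtmx_spd sV.
have [sB BV] := sqrtmxP sV.
set B := sqrtmx V in sB BV BiB BBi *; set Bi := invsqrtmx V in BiB BBi BiT *.
pose b := 1 + frobenius_norm B.
have b0 : 0 < b by rewrite ltr_pwDl ?frobenius_norm_ge0.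
(* f bounds |d - 1| for each eigenvalue d of A = B^-1 V' B^-1 below, where
   V' - V = B (A - 1) B *)
pose f := e / (b ^+ 2 * (1 + k%:R)).
have f0 : 0 < f by rewrite divr_gt0// mulr_gt0 ?exprn_gt0// ltr_pwDl.
(* the eigenvalues of A are the exponentials of those of its logarithm *)
have /cvgrPdist_lt/(_ f f0) := @continuous_expR R 0.
rewrite expR0 => /nbhs_norm0P[r /= r0 rP].
exists r => // V' sV'; rewrite /geodesic_dist -/Bi.
pose A := Bi *m V' *m Bi.
have sA : spd A.
  split; first by rewrite !trmx_mul BiT (proj1 sV') mulmxA.
  move=> x x0; have -> : x^T *m A *m x = (Bi *m x)^T *m V' *m (Bi *m x).
    by rewrite trmx_mul BiT !mulmxA.
  apply: (proj2 sV'); apply: contraNneq x0 => Bx0.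
  by rewrite -[x]mul1mx -BBi -mulmxA Bx0 mulmx0.
have [Q [d [Q1 d0 AE ->]]] : exists (Q : 'M[R]_k) (d : 'rV[R]_k),
    [/\ Q *m Q^T = 1%:M, forall i, 0 < d ord0 i, A = Q *m diag_mx d *m Q^T &
        logmx A = Q *m diag_mx (map_mx (@ln R) d) *m Q^T].
  have [Q [d [Q1 d0 AE]]] := spd_diagonalization sA.
  apply: (@xgetPex _ 0 [set L | exists (Q : 'M[R]_k) (d : 'rV[R]_k),
    [/\ Q *m Q^T = 1%:M, forall i, 0 < d ord0 i, A = Q *m diag_mx d *m Q^T &
        L = Q *m diag_mx (map_mx (@ln R) d) *m Q^T]]).
  by exists (Q *m diag_mx (map_mx (@ln R) d) *m Q^T), Q, d.
have QT1 : Q^T *m Q^T^T = 1%:M by rewrite trmxK; exact: mulmx1C.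
rewrite frobenius_norm_orthogonal_r// frobenius_norm_orthogonal_l// => lnr.
have df i : `|d 0 i - 1| < f.
  rewrite distrC -[d 0 i]lnK ?posrE//; apply: rP => /=.
  apply: le_lt_trans lnr.
  rewrite -(@ler_pXn2r _ 2)// ?nnegrE ?frobenius_norm_ge0//.
  rewrite real_normK ?num_real// frobenius_norm_diag (bigD1 i)//= mxE lerDl.
  by apply: sumr_ge0 => j _; rewrite sqr_ge0.
have VE : V' - V = B *m (A - 1%:M) *m B.
  rewrite mulmxBr mulmxBl mulmx1 BV /A !mulmxA BBi mul1mx.
  by rewrite -mulmxA BiB mulmx1.
have A1 : frobenius_norm (A - 1%:M) <= (1 + k%:R) * f.
  have -> : A - 1%:M = Q *m diag_mx (d - const_mx 1) *m Q^T.
    by rewrite linearB/= diag_const_mx mulmxBr mulmxBl mulmx1 Q1 AE.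
  rewrite frobenius_norm_orthogonal_r// frobenius_norm_orthogonal_l//.
  rewrite -(@ler_pXn2r _ 2)// ?nnegrE ?frobenius_norm_ge0//; last first.
    by rewrite mulr_ge0 ?addr_ge0// ltW.
  rewrite frobenius_norm_diag; apply: (@le_trans _ _ (\sum_(i < k) f ^+ 2)).
    apply: ler_sum => i _; rewrite !mxE -[leLHS]real_normK ?num_real//.
    by rewrite ler_pXn2r ?nnegrE// ltW.
  rewrite sumr_const card_ord -[leLHS]mulr_natl [leRHS]exprMn.
  rewrite ler_wpM2r ?sqr_ge0//.
  rewrite sqrrD expr1n -natrX; have : 0 <= (k ^ 2)%:R :> R by [].
  by have : 0 <= k%:R :> R by []; lra.
rewrite VE; apply: le_trans (frobenius_normM _ _) _.
apply: (@le_trans _ _ (b * ((1 + k%:R) * f) * b)).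
  rewrite ler_pM ?frobenius_norm_ge0//; last by rewrite lerDr.
  apply: le_trans (frobenius_normM _ _) _.
  by rewrite ler_pM ?frobenius_norm_ge0// lerDr.
rewrite le_eqVlt; apply/orP; left; apply/eqP; rewrite /f.
have k0 : 1 + k%:R != 0 :> R by rewrite gt_eqF// ltr_pwDl.
by field; rewrite (gt_eqF b0) k0.
Qed.
End spd.

(** * Uniform continuity of the sign vector and of its scores *)

Section sign_vector.
Variable R : realType.
Implicit Types m n k : nat.

(** The factor is [1 / frobenius_norm z'] only, so that the bound depends on
    the relative distance from [z] to [z']. *)
Lemma normalize_dist m n (z z' : 'M[R]_(m, n)) : z != 0 -> z' != 0 ->
  frobenius_norm ((frobenius_norm z')^-1 *: z' - (frobenius_norm z)^-1 *: z) <=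
  2 * frobenius_norm (z' - z) / frobenius_norm z'.
Proof.
move=> /frobenius_norm_gt0 z0 /frobenius_norm_gt0 z'0.
set a := frobenius_norm z'; set b := frobenius_norm z.
have -> : a^-1 *: z' - b^-1 *: z = a^-1 *: (z' - z) + (a^-1 - b^-1) *: z.
  by rewrite scalerBr scalerBl addrA subrK.
apply: le_trans (frobenius_normD _ _) _; rewrite !frobenius_normZ.
have -> : `|a^-1 - b^-1| * frobenius_norm z = `|a - b| / a.
  have -> : a^-1 - b^-1 = (b - a) / (a * b) by field; rewrite !gt_eqF.
  rewrite normrM normfV (@gtr0_norm _ (a * b)) ?mulr_gt0// distrC -/b.
  by field; rewrite !gt_eqF.
rewrite gtr0_norm ?invr_gt0//.
have : `|a - b| <= frobenius_norm (z' - z).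
  rewrite ler_norml; apply/andP; split.
    rewrite lerNl opprB lerBlDl -[frobenius_norm (z' - z)]frobenius_normN opprB.
    by apply: le_trans (frobenius_normD _ _); rewrite addrC subrK.
  rewrite lerBlDl; apply: le_trans (frobenius_normD _ _).
  by rewrite addrC subrK.
move=> ab; rewrite mulrC -mulrDl ler_wpM2r ?invr_ge0 ?frobenius_norm_ge0//.
by rewrite mulr_natl mulr2n lerD2l.
Qed.

Lemma invsqrtmx_mul_neq0 k (V : 'M[R]_k) (y : 'cV[R]_k) :
  spd V -> y != 0 -> invsqrtmx V *m y != 0.
Proof.
move=> /invsqrtmx_spd[_ BBi _]; apply: contraNneq => Bi0.
by rewrite -[y]mul1mx -BBi -mulmxA Bi0 mulmx0.
Qed.

Lemma sign_vec_norm k (theta : 'cV[R]_k) V x : spd V ->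
  frobenius_norm (sign_vec theta V x) = (tuple_col x != theta)%:R.
Proof.
move=> sV; rewrite /sign_vec; case: eqVneq => [_|xt] /=.
  exact: frobenius_norm0.
rewrite euclidean_normE frobenius_normZ.
rewrite ger0_norm ?invr_ge0 ?frobenius_norm_ge0// mulVf//.
apply: contra_neq (invsqrtmx_mul_neq0 sV _).
  exact: frobenius_norm0_eq.
by rewrite subr_eq0.
Qed.

Lemma sign_vec_norm_le1 k (theta : 'cV[R]_k) V x : spd V ->
  frobenius_norm (sign_vec theta V x) <= 1.
Proof. by move=> sV; rewrite sign_vec_norm//; case: (_ != _). Qed.

(** Continuity in [V] of the sign vector, uniformly in the center and in the
    observation. *)
Lemma sign_vec_continuous k (V : 'M[R]_k) (e : R) : spd V -> 0 < e ->
  exists2 r : R, 0 < r & forall V', spd V' -> geodesic_dist V V' < r ->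
    forall theta x,
      frobenius_norm (sign_vec theta V' x - sign_vec theta V x) <= e.
Proof.
move=> sV e0; have [c c0 lipc] := sqrtmx_lipschitz sV.
have [BiB BBi _] := invsqrtmx_spd sV.
pose b := 1 + frobenius_norm (invsqrtmx V).
have b0 : 0 < b by rewrite ltr_pwDl ?frobenius_norm_ge0.
have [|r r0 rP] := @geodesic_dist_small _ _ V (e / (2 * b * c)) sV.
  by rewrite divr_gt0 ?mulr_gt0.
exists r => // V' sV' /(rP _ sV') VV' theta x.
have {}VV' : frobenius_norm (sqrtmx V' - sqrtmx V) <= e / (2 * b).
  apply: le_trans (lipc _ sV') _.
  apply: le_trans (ler_wpM2l (ltW c0) VV') _.
  rewrite le_eqVlt; apply/orP; left; apply/eqP; field.
  by rewrite (gt_eqF b0) gt_eqF.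
rewrite /sign_vec; case: eqVneq => [_|xt].
  by rewrite subrr frobenius_norm0 ltW.
have y0 : tuple_col x - theta != 0 by rewrite subr_eq0.
move: (_ - theta) y0 => y y0 /=; rewrite !euclidean_normE.
have z0 := invsqrtmx_mul_neq0 sV y0; have z'0 := invsqrtmx_mul_neq0 sV' y0.
apply: le_trans (normalize_dist z0 z'0) _.
set z := _ *m y in z0 *; set z' := _ *m y in z'0 *.
(* z - z' = V^(-1/2) (V'^(1/2) - V^(1/2)) z', proportional to z' *)
have -> : z' - z = - (invsqrtmx V *m (sqrtmx V' - sqrtmx V) *m z').
  rewrite mulmxBr BiB mulmxBl mul1mx opprB; congr (_ - _).
  have [_ B'Bi' _] := invsqrtmx_spd sV'.
  by rewrite /z' mulmxA -(mulmxA _ _ (invsqrtmx V')) B'Bi' mulmx1.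
rewrite frobenius_normN; have nz' := frobenius_norm_gt0 z'0.
rewrite ler_pdivrMr//.
apply: (@le_trans _ _ (2 * (b * (e / (2 * b)) * frobenius_norm z'))).
  rewrite ler_wpM2l//; apply: le_trans (frobenius_normM _ _) _.
  rewrite ler_wpM2r ?frobenius_norm_ge0//.
  apply: le_trans (frobenius_normM _ _) _.
  by rewrite ler_pM ?frobenius_norm_ge0// lerDr.
by rewrite le_eqVlt; apply/orP; left; apply/eqP; field; rewrite (gt_eqF b0).
Qed.

(** The linear functional of the sign shape vector given by the vectorization
    of a matrix [A]. *)
Definition shape_score k (A : 'M[R]_k) theta V x : R :=
  ((vec_cols A)^T *m sign_shape theta V x) ord0 ord0.

(** [vec_cols] is an isometry for the Frobenius inner product. *)
Lemma vec_cols_dot m n (A B : 'M[R]_(m, n)) :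
  ((vec_cols A)^T *m vec_cols B) ord0 ord0 = \tr (A *m B^T).
Proof.
rewrite /vec_cols trmxK mxtrace_mul_tr exchange_big pair_bigA/= mxE.
rewrite (reindex _ (curry_mxvec_bij _ _))/=; apply: eq_bigr => -[i j] _ /=.
by rewrite [X in _ * X]mxE !mxvecE !mxE.
Qed.

Lemma shape_scoreE k (A : 'M[R]_k) theta V x :
  shape_score A theta V x =
  \tr (A *m (sign_vec theta V x *m (sign_vec theta V x)^T)) - k%:R^-1 * \tr A.
Proof.
rewrite /shape_score /sign_shape vec_cols_dot linearB/= linearZ/= trmx1.
rewrite trmx_mul trmxK mulmxBr -scalemxAr mulmx1.
by rewrite raddfB/= mxtraceZ.
Qed.

Lemma vec_cols_norm m n (A : 'M[R]_(m, n)) :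
  euclidean_norm (vec_cols A) = frobenius_norm A.
Proof.
rewrite euclidean_normE /frobenius_norm -[in RHS]vec_cols_dot mxtrace_mulC.
by rewrite trace_mx11.
Qed.

Lemma unit_sphere_vec_cols k (u : 'cV[R]_(k * k)) : unit_sphere u ->
  exists2 A : 'M[R]_k, frobenius_norm A = 1 & u = vec_cols A.
Proof.
move=> u1; have uE : u = vec_cols (vec_mx u^T)^T.
  by rewrite /vec_cols trmxK vec_mxK trmxK.
by exists (vec_mx u^T)^T => //; rewrite -vec_cols_norm -uE.
Qed.

Lemma shape_score_continuous k (V : 'M[R]_k) (e : R) : spd V -> 0 < e ->
  exists2 r : R, 0 < r & forall V', spd V' -> geodesic_dist V V' < r ->
    forall A theta x, frobenius_norm A = 1 ->
      `|shape_score A theta V' x - shape_score A theta V x| <= e.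
Proof.
move=> sV e0; have [|r r0 rP] := @sign_vec_continuous k V (e / 2) sV.
  by rewrite divr_gt0.
exists r => // V' sV' /(rP _ sV') VV' A theta x A1; rewrite !shape_scoreE.
have {VV'} := VV' theta x.
have := sign_vec_norm_le1 theta x sV; have := sign_vec_norm_le1 theta x sV'.
set U := sign_vec _ V x; set U' := sign_vec _ V' x => U'1 U1 UU'.
rewrite opprB addrA subrK -raddfB/= -mulmxBr -[U' *m _ - _]trmxK.
apply: le_trans (frobenius_cauchy_schwarz_abs _ _) _.
rewrite A1 mul1r frobenius_norm_tr.
have -> : U' *m U'^T - U *m U^T = (U' - U) *m U'^T + U *m (U' - U)^T.
  by rewrite mulmxBl linearB/= mulmxBr addrA subrK.
apply: le_trans (frobenius_normD _ _) _.
have -> : e = (e / 2) * 1 + 1 * (e / 2) by field.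
rewrite lerD//; apply: le_trans (frobenius_normM _ _) _;
  by rewrite ler_pM ?frobenius_norm_ge0// frobenius_norm_tr.
Qed.

End sign_vector.

(** * Zero sets of polynomial functions *)

Section polynomial_null_sets.
Variable R : realType.
Implicit Types n : nat.

(** Polynomial functions on [R^n]: the functions generated by the constants and
    the coordinates under sums and products. *)
Inductive polyfun n : (Rtuple R n -> R) -> Prop :=
| polyfun_cst c : polyfun (fun=> c)
| polyfun_coord i : polyfun (fun x => tnth x i)
| polyfun_add f g : polyfun f -> polyfun g -> polyfun (fun x => f x + g x)
| polyfun_mul f g : polyfun f -> polyfun g -> polyfun (fun x => f x * g x).

Lemma polyfun_sum n (I : Type) (r : seq I) (F : I -> Rtuple R n -> R) :
  (forall i, polyfun (F i)) -> polyfun (fun x => \sum_(i <- r) F i x).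
Proof.
move=> FP; elim: r => [|i r IH].
  by rewrite (_ : (fun _ => _) = fun=> 0);
    [exact: polyfun_cst|apply/funext => x; rewrite big_nil].
rewrite (_ : (fun _ => _) = fun x => F i x + \sum_(j <- r) F j x).
  exact: polyfun_add.
by apply/funext => x; rewrite big_cons.
Qed.

Lemma measurable_polyfun n (f : Rtuple R n -> measurableTypeR R) :
  polyfun f -> measurable_fun [set: _] f.
Proof.
elim=> [c|i|g h _ mg _ mh|g h _ mg _ mh].
- exact: measurable_cst.
- exact: measurable_tnth.
- exact: measurable_funD.
- exact: measurable_funM.
Qed.

Lemma measurable_polyfun_zero n (f : Rtuple R n -> R) :
  polyfun f -> measurable [set x | f x = 0].
Proof.
move=> fP; rewrite -[X in measurable X]setTI.
exact: (measurable_polyfun fP measurableT (measurable_set1 0)).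
Qed.

(** A polynomial function is a polynomial in the first coordinate, whose
    coefficients are polynomial functions of the other coordinates. *)
Lemma polyfun_slice n (f : Rtuple R n.+1 -> R) : polyfun f ->
  exists2 p : Rtuple R n -> {poly R},
    (forall t x, f (tuple_cons (t, x)) = (p x).[t]) &
    forall i, polyfun (fun x => (p x)`_i).
Proof.
elim=> [c|i|g h _ [p gp pP] _ [q hq qP]|g h _ [p gp pP] _ [q hq qP]].
- exists (fun=> c%:P) => [t x|i]; first by rewrite hornerC.
  exact: polyfun_cst.
- have [j ->|->] := unliftP ord0 i.
    exists (fun x => (tnth x j)%:P) => [t x|l].
      by rewrite hornerC tnthS.
    case: l => [|l].
      rewrite (_ : (fun _ => _) = fun x => tnth x j).
        exact: polyfun_coord.
      by apply/funext => x; rewrite coefC.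
    rewrite (_ : (fun _ => _) = fun=> 0).
      exact: polyfun_cst.
    by apply/funext => x; rewrite coefC.
  exists (fun=> 'X) => [t x|l]; first by rewrite hornerX tnth0.
  exact: polyfun_cst.
- exists (fun x => p x + q x) => [t x|l]; first by rewrite hornerD gp hq.
  rewrite (_ : (fun _ => _) = fun x => (p x)`_l + (q x)`_l).
    exact: polyfun_add.
  by apply/funext => x; rewrite coefD.
- exists (fun x => p x * q x) => [t x|l]; first by rewrite hornerM gp hq.
  rewrite (_ : (fun _ => _) =
      fun x => \sum_(j <- index_enum 'I_l.+1) (p x)`_j * (q x)`_(l - j)).
    by apply: polyfun_sum => j; exact: polyfun_mul.
  by apply/funext => x; rewrite coefM.
Qed.

Lemma poly_roots_countable (p : {poly R}) : p != 0 ->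
  countable [set t | root p t].
Proof.
move=> p0; apply: finite_set_countable; apply: contrapT.
move=> /(infinite_set_fset (size p))[/= C Cp sC].
have := @max_poly_roots _ p (enum_fset C) p0 _ (fset_uniq C).
rewrite ltnNge sC => H; apply/notF/H/allP => t tC.
exact: Cp.
Qed.

(** The zero set of a polynomial function that does not vanish identically
    is negligible: outside a negligible set of values of the last [n]
    coordinates, the slice of the polynomial is nonzero, hence has finitely
    many roots. *)
Lemma polyfun_zero_null n (f : Rtuple R n -> R) x0 : polyfun f -> f x0 != 0 ->
  lebesgue_tuple R n [set x | f x = 0] = 0%E.
Proof.
elim: n f x0 => [|n IH] f x0 fP fx0.
  rewrite (_ : [set x | f x = 0] = set0) ?measure0//.
  apply/seteqP; split=> // x /= fx; move: fx0.
  by rewrite (_ : x0 = x) ?fx ?eqxx//; apply/eq_from_tnth => -[].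
have [p fp pP] := polyfun_slice fP.
have x0E : x0 = tuple_cons (thead x0, [tuple of behead x0]).
  by rewrite [LHS]tuple_eta; exact/val_inj.
have [i pi0] : exists i, (p [tuple of behead x0])`_i != 0.
  apply: contrapT => p0; move: fx0; rewrite x0E fp.
  rewrite (_ : p _ = 0) ?horner0 ?eqxx//.
  apply/polyP => i; rewrite coef0; apply/eqP; apply: contrapT => /negP pi.
  by apply: p0; exists i.
have N0 := IH _ _ (pP i) pi0.
set N := [set x | _] in N0.
have mN : measurable N by exact: measurable_polyfun_zero (pP i).
pose Z := @tuple_cons R n @^-1` [set x | f x = 0].
have mZ : measurable Z.
  rewrite -[Z]setTI; apply: measurable_tuple_cons => //.
  exact: measurable_polyfun_zero.
(* Tonelli, integrating first over the added coordinate *)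
transitivity ((lebesgue_measure \x lebesgue_tuple R n)%E Z); first by [].
rewrite (@product_measure_unique _ _ _ _ _ _ _
  (lebesgue_measure \x^ lebesgue_tuple R n)%E)//; last first.
  by move=> A B mA mB; exact: product_measure2E.
rewrite /= /product_measure2.
rewrite (@ae_eq_integral _ _ _ _ _ (cst 0%E))//.
- by rewrite integral0.
- exact: measurable_fun_ysection.
exists N; split=> // x /= /not_implyP[_ Zx]; apply: contrapT => Nx; apply: Zx.
apply: countable_lebesgue_measure0.
apply: sub_countable (poly_roots_countable (p := p x) _).
  apply: subset_card_le => t; rewrite /ysection/= inE /Z/= fp => pt.
  exact/eqP.
by apply/eqP => px0; apply: Nx; rewrite /N/= px0 coef0.
Qed.

End polynomial_null_sets.

(** * Continuity of a probability along superlevel sets *)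

Section probability_facts.
Variables (d : measure_display) (T : measurableType d) (R : realType).
Variable P : probability T R.
Implicit Types f : T -> measurableTypeR R.

Lemma measurable_superlevel f (c : R) : measurable_fun [set: T] f ->
  measurable [set x | c <= f x].
Proof.
move=> mf; rewrite -[X in measurable X]setTI.
have := mf measurableT _ (measurable_itv `[c, +oo[).
by congr (measurable (_ `&` _)); apply/seteqP; split=> x /=;
  rewrite in_itv/= andbT.
Qed.

Lemma measurable_strict_superlevel f (c : R) : measurable_fun [set: T] f ->
  measurable [set x | c < f x].
Proof.
move=> mf; rewrite -[X in measurable X]setTI.
have := mf measurableT _ (measurable_itv `]c, +oo[).
by congr (measurable (_ `&` _)); apply/seteqP; split=> x /=;
  rewrite in_itv/= andbT.
Qed.

Lemma probability_superlevel_approx f (a : \bar R) :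
  measurable_fun [set: T] f ->
  (P [set x | (0 <= f x)%R] < a)%E ->
  exists2 e : R, 0 < e & (P [set x | (- e <= f x)%R] < a)%E.
Proof.
move=> mf Pa; pose F (n : nat) := [set x | - n.+1%:R^-1 <= f x].
have mF n : measurable (F n) by exact: measurable_superlevel.
have FE : \bigcap_n F n = [set x | 0 <= f x].
  apply/seteqP; split=> x /= fx; last first.
    by move=> n _; apply: le_trans fx; rewrite oppr_le0.
  rewrite leNgt; apply/negP => fx0.
  have nfx0 : 0 < - f x by rewrite oppr_gt0.
  have [n _ /(_ n (leqnn n))/=] := near_infty_natSinv_lt (PosNum nfx0).
  by rewrite ltrNr ltNge (fx n).
have PF : P \o F @ \oo --> P (\bigcap_n F n).
  apply: nonincreasing_cvg_mu => //.
  - by rewrite (le_lt_trans (probability_le1 P (mF 0%N)))// ltry.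
  - by rewrite FE; exact: measurable_superlevel.
  - move=> n m nm; apply/subsetPset => x; apply: le_trans.
    by rewrite lerN2 lef_pV2 ?posrE// ler_nat.
have [n _ /(_ n (leqnn n)) Fn] : \forall n \near \oo, (P (F n) < a)%E.
  apply: (PF [set y | y < a]%E); apply: open_nbhs_nbhs; split.
    exact: open_ereal_lt_ereal.
  by rewrite /= FE.
by exists n.+1%:R^-1.
Qed.

Lemma probability_strict_superlevel_approx f (a : \bar R) :
  measurable_fun [set: T] f -> (a < P [set x | (0 < f x)%R])%E ->
  exists2 e : R, 0 < e & (a < P [set x | (e < f x)%R])%E.
Proof.
move=> mf Pa; pose F (n : nat) := [set x | n.+1%:R^-1 < f x].
have mF n : measurable (F n) by exact: measurable_strict_superlevel.
have FE : \bigcup_n F n = [set x | 0 < f x].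
  apply/seteqP; split=> x /= => [[n _]|fx]; first by apply: lt_trans.
  have [n _ /(_ n (leqnn n))/= fn] := near_infty_natSinv_lt (PosNum fx).
  by exists n.
have PF : P \o F @ \oo --> P (\bigcup_n F n).
  apply: nondecreasing_cvg_mu => //.
  - by rewrite FE; exact: measurable_strict_superlevel.
  - move=> n m nm; apply/subsetPset => x; apply: le_lt_trans.
    by rewrite lef_pV2 ?posrE// ler_nat.
have [n _ /(_ n (leqnn n)) Fn] : \forall n \near \oo, (a < P (F n))%E.
  apply: (PF [set y | a < y]%E); apply: open_nbhs_nbhs; split.
    exact: open_ereal_gt_ereal.
  by rewrite /= FE.
by exists n.+1%:R^-1.
Qed.

Lemma le_probability_null (E F N : set T) : measurable E -> measurable F ->
  measurable N -> P N = 0%E -> E `\` N `<=` F -> (P E <= P F)%E.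
Proof.
move=> mE mF mN N0 EF; apply: (@le_trans _ _ (P (F `|` N))).
  rewrite le_measure ?inE//; first exact: measurableU.
  move=> x Ex; have [Nx|Nx] := pselect (N x); first by right.
  by left; apply: EF.
apply: le_trans (measureU2 _ mF mN) _.
by rewrite [X in (_ + X)%E](_ : _ = 0%E) ?adde0.
Qed.

End probability_facts.

(** * Scores as functions of the observation *)

Section shape_depth_facts.
Variables (R : realType) (k : nat).
Implicit Types (theta : 'cV[R]_k) (V A N : 'M[R]_k) (x : Rtuple R k).

Lemma polyfun_mulmx_coord theta (B : 'M[R]_k) i :
  polyfun (fun x => (B *m (tuple_col x - theta)) i 0).
Proof.
rewrite (_ : (fun _ => _) =
    fun x => \sum_j B i j * (tnth x j + - theta j 0)).
  apply: polyfun_sum => j; apply: polyfun_mul; first exact: polyfun_cst.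
  by apply: polyfun_add; [exact: polyfun_coord|exact: polyfun_cst].
by apply/funext => x; rewrite mxE; apply: eq_bigr => j _; rewrite !mxE.
Qed.

Lemma polyfun_quadratic theta (B A : 'M[R]_k) :
  polyfun (fun x =>
    let z := B *m (tuple_col x - theta) in \tr (A *m (z *m z^T))).
Proof.
rewrite (_ : (fun _ => _) =
  fun x => \sum_i \sum_j A i j * ((B *m (tuple_col x - theta)) j 0 *
    (B *m (tuple_col x - theta)) i 0)).
  apply: polyfun_sum => i; apply: polyfun_sum => j.
  apply: polyfun_mul; first exact: polyfun_cst.
  by apply: polyfun_mul; exact: polyfun_mulmx_coord.
apply/funext => x /=; apply: eq_bigr => i _; rewrite mxE.
by apply: eq_bigr => j _; congr (_ * _); rewrite mxE big_ord1 [_^T _ _]mxE.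
Qed.

(** The case [x = theta] needs no separate treatment, since [0^-1 = 0]. *)
Lemma sign_vecE theta V x :
  let z := invsqrtmx V *m (tuple_col x - theta) in
  sign_vec theta V x = (frobenius_norm z)^-1 *: z.
Proof.
rewrite /sign_vec; case: eqVneq => [->|_] /=; last by rewrite euclidean_normE.
by rewrite subrr mulmx0 scaler0.
Qed.

(** Up to a nonnegative factor and a constant term, the score is a quadratic
    polynomial in [x]; writing the factor as a real power exhibits its
    measurability. *)
Lemma shape_score_quadratic A theta V x :
  let z := invsqrtmx V *m (tuple_col x - theta) in
  shape_score A theta V x =
  \tr (1%:M *m (z *m z^T)) `^ (- 2^-1) ^+ 2 * \tr (A *m (z *m z^T)) -
  k%:R^-1 * \tr A.
Proof.
move=> z; rewrite shape_scoreE sign_vecE -/z; congr (_ - _).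
rewrite linearZ/= -scalemxAl -!scalemxAr !mxtraceZ mulrA -expr2.
congr (_ ^+ 2 * _).
rewrite mul1mx powRN powR12_sqrt//.
by rewrite -frobenius_norm_sqr sqr_ge0.
Qed.

Lemma measurable_shape_score A theta V :
  measurable_fun [set: _] (shape_score A theta V : _ -> measurableTypeR R).
Proof.
rewrite (_ : shape_score A theta V = fun x =>
  let z := invsqrtmx V *m (tuple_col x - theta) in
  \tr (1%:M *m (z *m z^T)) `^ (- 2^-1) ^+ 2 * \tr (A *m (z *m z^T)) +
  - (k%:R^-1 * \tr A)); last first.
  by apply/funext => x; rewrite shape_score_quadratic.
apply: measurable_funD; last exact: measurable_cst.
apply: measurable_funM.
  apply: measurable_funX.
  apply: (measurableT_comp (measurable_powR _)).
  exact: measurable_polyfun (polyfun_quadratic _ _ _).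
exact: measurable_polyfun (polyfun_quadratic _ _ _).
Qed.

Lemma shape_depthE theta V (P : probability (Rtuple R k) R) :
  shape_depth theta V P =
  ereal_inf [set P [set x | 0 <= shape_score A theta V x]
            | A in [set A | frobenius_norm A = 1]].
Proof.
congr ereal_inf; apply/seteqP; split=> y -[].
  by move=> u /unit_sphere_vec_cols[A A1 uA] <-; exists A; rewrite ?uA.
move=> A A1 <-; exists (vec_cols A) => //.
by rewrite /unit_sphere/= vec_cols_norm.
Qed.

End shape_depth_facts.

(** * Upper semicontinuity of the depth *)

Section semicontinuity.
Variable R : realType.

Lemma shapeMx_spd k (V : shapeMx R k) : spd V.
Proof. by have := valP V; rewrite inE => -[]. Qed.

Lemma shape_depth_lt_near k theta (P : probability (Rtuple R k) R)
    (V : shapeMx R k) (a : \bar R) : (shape_depth theta V P < a)%E ->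
  exists2 r : R, 0 < r & forall V' : shapeMx R k, geodesic_dist V V' < r ->
    (shape_depth theta V' P < a)%E.
Proof.
rewrite shape_depthE => /ereal_inf_lt[_ [A A1 <-]].
move=> /(probability_superlevel_approx (measurable_shape_score _ _ _))[e e0 Pe].
have [r r0 rP] := shape_score_continuous (shapeMx_spd V) e0.
exists r; first exact: r0.
move=> V' /(rP _ (shapeMx_spd V')) VV'.
rewrite shape_depthE; apply: le_lt_trans Pe.
apply: ge_ereal_inf; exists (P [set x | 0 <= shape_score A theta V' x]).
  by exists A.
apply: le_measure; rewrite ?inE.
- by apply: measurable_superlevel; exact: measurable_shape_score.
- by apply: measurable_superlevel; exact: measurable_shape_score.
move=> x /= s0; have := VV' A theta x A1; rewrite ler_norml => /andP[_].
by rewrite lerBlDr; lra.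
Qed.

(** * The compact set of normalized deviatoric matrices *)

Lemma sum_continuous (T : topologicalType) n (f : 'I_n -> T -> R) :
  (forall i, continuous (f i)) -> continuous (fun t => \sum_i f i t : R).
Proof.
move=> cf; apply: (@continuous_big R 'I_n +%R 0 xpredT) => //.
by move=> x; exact: add_continuous.
Qed.

Lemma frobenius_norm_continuous (T : topologicalType) m n
    (f : T -> 'M[R]_(m, n)) : (forall i j, continuous (fun t => f t i j : R)) ->
  continuous (fun t => frobenius_norm (f t) : R).
Proof.
move=> cf t; apply: (@continuous_comp _ _ _ (fun t => \tr (f t *m (f t)^T))
  (@Num.sqrt R)); last exact: sqrt_continuous.
move: t; rewrite (_ : (fun _ => _) = fun t => \sum_i \sum_j f t i j * f t i j).
  apply: sum_continuous => i; apply: sum_continuous => j t.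
  by apply: cvgM; exact: cf.
by apply/funext => t; rewrite mxtrace_mul_tr.
Qed.

Lemma closed_level (T : topologicalType) (f : T -> R) (c : R) :
  continuous f -> closed [set t | f t = c].
Proof.
by move=> cf; apply: (closed_comp _ (@closed_eq R c)) => t _; exact: cf.
Qed.

(** Symmetric matrices with trace zero and unit norm, encoded as row vectors
    through [vec_mx]. *)
Definition deviatoric_sphere k : set 'rV[R]_(k * k) :=
  [set v | [/\ (vec_mx v)^T = vec_mx v, \tr (vec_mx v) = 0 &
               frobenius_norm (vec_mx v) = 1]].

Lemma vec_mx_coord_continuous m n i j :
  continuous (fun v : 'rV[R]_(m * n) => vec_mx v i j : R).
Proof.
rewrite (_ : (fun _ => _) = fun v : 'rV[R]_(m * n) => v 0 (mxvec_index i j)).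
  exact: coord_continuous.
by apply/funext => v; rewrite mxE.
Qed.

Lemma compact_deviatoric_sphere k : compact (@deviatoric_sphere k).
Proof.
apply: bounded_closed_compact.
  exists 1; split; first exact: num_real.
  move=> b b1 v [_ _ v1] /=; apply: le_trans (ltW b1).
  rewrite [leLHS]/Num.norm/= mx_normrE.
  apply/bigmax_leP; split=> // -[i j] _ /=.
  rewrite -(@ler_pXn2r _ 2)// ?nnegrE// expr1n -(expr1n _ 2) -v1.
  have [/= [a c] ->] : exists ac, j = uncurry (@mxvec_index k k) ac.
    by have [g _ gK] := curry_mxvec_bij k k; exists (g j); rewrite gK.
  rewrite frobenius_norm_sqr_sum real_normK ?num_real//.
  rewrite (bigD1 a)//= (bigD1 c)//= !mxE (ord1 i).
  by rewrite -addrA lerDl addr_ge0// sumr_ge0// => *; rewrite ?sumr_ge0// => *;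
    rewrite sqr_ge0.
rewrite (_ : @deviatoric_sphere k =
  [set v | frobenius_norm ((vec_mx v)^T - vec_mx v) = 0] `&`
  ([set v | \tr (vec_mx v) = 0] `&` [set v | frobenius_norm (vec_mx v) = 1])).
  apply: closedI.
    apply: closed_level; apply: frobenius_norm_continuous => i j.
    rewrite (_ : (fun _ => _) =
        fun v : 'rV[R]_(k * k) => vec_mx v j i - vec_mx v i j).
      move=> v; apply: (@cvgB _ _ _ _ (nbhs_filter v));
        exact: vec_mx_coord_continuous.
    by apply/funext => v; rewrite !mxE.
  apply: closedI.
    apply: closed_level; apply: sum_continuous => i.
    exact: vec_mx_coord_continuous.
  apply: closed_level; apply: frobenius_norm_continuous => i j.
  exact: vec_mx_coord_continuous.
apply/seteqP; split=> v /= [].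
  move=> vT v0 v1; split=> //; rewrite vT subrr.
  exact: frobenius_norm0.
by move=> /frobenius_norm0_eq/eqP; rewrite subr_eq0 => /eqP ? [].
Qed.

(** * Reduction of scores to deviatoric matrices *)

Lemma shape_score_dist k (A N V : 'M[R]_k) theta x :
  spd V -> \tr A = \tr N ->
  `|shape_score A theta V x - shape_score N theta V x| <=
  frobenius_norm (A - N).
Proof.
move=> sV trAN; rewrite !shape_scoreE trAN opprB addrA subrK -raddfB/= -mulmxBl.
set U := sign_vec _ _ _.
have U1 : frobenius_norm U <= 1 by exact: sign_vec_norm_le1.
have -> : U *m U^T = (U *m U^T)^T by rewrite trmx_mul trmxK.
apply: le_trans (frobenius_cauchy_schwarz_abs _ _) _.
rewrite ler_piMr ?frobenius_norm_ge0//; apply: le_trans (frobenius_normM _ _) _.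
rewrite frobenius_norm_tr -[leRHS]mulr1.
by rewrite ler_pM ?frobenius_norm_ge0.
Qed.

(** The symmetric traceless part of [A]; only this part contributes to the
    score of an observation distinct from the center. *)
Definition deviator k (A : 'M[R]_k) : 'M[R]_k :=
  2^-1 *: (A + A^T) - (k%:R^-1 * \tr A)%:M.

Lemma deviator_tr k (A : 'M[R]_k) : (deviator A)^T = deviator A.
Proof.
rewrite /deviator [LHS]linearB/= tr_scalar_mx [X in X - _]linearZ/=.
by rewrite [(A + _)^T]linearD/= trmxK [A^T + A]addrC.
Qed.

Lemma mxtrace_deviator k (A : 'M[R]_k) : (0 < k)%N -> \tr (deviator A) = 0.
Proof.
move=> k0; rewrite raddfB/= mxtraceZ mxtraceD mxtrace_tr mxtrace_scalar.
rewrite -mulr_natr.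
have : k%:R != 0 :> R by rewrite pnatr_eq0 -lt0n.
by move=> ?; field.
Qed.

Lemma shape_score_deviator k (A V : 'M[R]_k) theta x : (0 < k)%N -> spd V ->
  tuple_col x != theta ->
  shape_score (deviator A) theta V x = shape_score A theta V x.
Proof.
move=> k0 sV xt; rewrite !shape_scoreE mxtrace_deviator// mulr0 subr0.
set U := sign_vec _ _ _.
have U1 : \tr (U *m U^T) = 1.
  by rewrite -frobenius_norm_sqr sign_vec_norm// xt expr1n.
rewrite /deviator mulmxBl mul_scalar_mx raddfB/= mxtraceZ U1 mulr1.
congr (_ - _).
rewrite -scalemxAl mxtraceZ mulmxDl mxtraceD.
have -> : \tr (A^T *m (U *m U^T)) = \tr (A *m (U *m U^T)).
  by rewrite -[RHS]mxtrace_tr trmx_mul [(U *m _)^T]trmx_mul trmxK mxtrace_mulC.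
by field.
Qed.

Lemma shape_scoreZ k (c : R) (A V : 'M[R]_k) theta x :
  shape_score (c *: A) theta V x = c * shape_score A theta V x.
Proof. by rewrite !shape_scoreE -scalemxAl !mxtraceZ; ring. Qed.

Lemma tuple_col_mktuple k (v : 'cV[R]_k) :
  tuple_col ([tuple v i 0 | i < k] : Rtuple R k) = v.
Proof. by apply/colP => i; rewrite mxE tnth_mktuple. Qed.

(** * Lower semicontinuity of the depth *)

Section absolutely_continuous.
Variables (k : nat) (theta : 'cV[R]_k) (P : probability (Rtuple R k) R).
Hypothesis k_gt0 : (0 < k)%N.
Hypothesis P_ac : P `<< lebesgue_tuple R k.

Lemma ac_polyfun_zero (f : Rtuple R k -> R) x0 : polyfun f -> f x0 != 0 ->
  P [set x | f x = 0] = 0%E.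
Proof.
move=> fP fx0; move/null_content_dominatesP : P_ac; apply.
  exact: measurable_polyfun_zero.
exact: polyfun_zero_null fP fx0.
Qed.

(** For a nonzero symmetric traceless matrix, a null score is negligible. *)
Lemma deviatoric_score_pos (N V : 'M[R]_k) : spd V -> N^T = N -> \tr N = 0 ->
  N != 0 ->
  (P [set x | (0 <= shape_score N theta V x)%R] <=
   P [set x | (0 < shape_score N theta V x)%R])%E.
Proof.
move=> sV symN trN N0.
pose f x :=
  let z := invsqrtmx V *m (tuple_col x - theta) in \tr (N *m (z *m z^T)).
have fP : polyfun f by exact: polyfun_quadratic.
have [w w0] : exists w : 'cV[R]_k, \tr (N *m (w *m w^T)) != 0.
  apply: contrapT => Nw; move/eqP: N0; apply.
  have [Q [d [Q1 NE]]] := symmetric_diagonalization symN.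
  rewrite NE; suff -> : d = 0 by rewrite linear0 mulmx0 mul0mx.
  apply/rowP => i; rewrite -(conj_diag_col d i Q1) -NE [RHS]mxE.
  apply/eqP/negPn/negP => Nw0; apply: Nw; exists (col i Q).
  by rewrite mulmxA mxtrace_mulC mulmxA trace_mx11.
have fx0 : f [tuple (theta + sqrtmx V *m w) i 0 | i < k] != 0.
  rewrite /f tuple_col_mktuple; set z := invsqrtmx V *m _.
  rewrite (_ : z = w)//.
  rewrite /z addrAC subrr add0r mulmxA.
  by have [-> _ _] := invsqrtmx_spd sV; rewrite mul1mx.
apply: (le_probability_null _ _ (measurable_polyfun_zero fP)
  (ac_polyfun_zero fP fx0)).
- by apply: measurable_superlevel; exact: measurable_shape_score.
- by apply: measurable_strict_superlevel; exact: measurable_shape_score.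
move=> x /= [s0 fx]; rewrite lt_def s0 andbT; apply: contra_notN fx.
rewrite shape_scoreE trN mulr0 subr0 sign_vecE linearZ/= -scalemxAl -!scalemxAr.
rewrite !mxtraceZ mulrA -expr2 mulf_eq0 sqrf_eq0 invr_eq0 => /orP[/eqP|/eqP//].
by move=> /frobenius_norm0_eq z0; rewrite /f z0 mul0mx mulmx0 mxtrace0.
Qed.

Lemma shape_depth_gt_near (V : shapeMx R k) (a : \bar R) :
  (a < shape_depth theta V P)%E ->
  exists2 r : R, 0 < r & forall V' : shapeMx R k, geodesic_dist V V' < r ->
    (a <= shape_depth theta V' P)%E.
Proof.
move=> aD; have sV := shapeMx_spd V.
have mS A W e : measurable [set x | e < shape_score A theta W x].
  by apply: measurable_strict_superlevel; exact: measurable_shape_score.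
have mW A W e : measurable [set x | e <= shape_score A theta W x].
  by apply: measurable_superlevel; exact: measurable_shape_score.
have Dle A : frobenius_norm A = 1 ->
    (shape_depth theta V P <= P [set x | (0 <= shape_score A theta V x)%R])%E.
  by move=> A1; rewrite shape_depthE; apply: ereal_inf_lbound; exists A.
(* one margin e serves all normalized deviatoric matrices, by compactness *)
have : \forall e \near 0^'+, @deviatoric_sphere k `<=`
    [set v | (a < P [set x | (e < shape_score (vec_mx v) theta V x)%R])%E].
  have := @compact_deviatoric_sphere k.
  move=> /compact_near_coveringP/near_covering_withinP; apply.
  move=> v0 [symv0 trv0 v01].
  have v00 : vec_mx v0 != 0.
    apply: contra_eq_neq v01 => ->.
    by rewrite frobenius_norm0 eq_sym oner_eq0.
  have [e e0 Pe] : exists2 e, 0 < e &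
      (a < P [set x | (e < shape_score (vec_mx v0) theta V x)%R])%E.
    apply: probability_strict_superlevel_approx.
      exact: measurable_shape_score.
    apply: lt_le_trans aD _; apply: le_trans (Dle _ v01) _.
    exact: deviatoric_score_pos.
  have vv0 : \forall v \near v0, frobenius_norm (vec_mx v - vec_mx v0) < e / 2.
    pose g (v : 'rV[R]_(k * k)) := frobenius_norm (vec_mx v - vec_mx v0).
    have cg : continuous g.
      apply: frobenius_norm_continuous => i j.
      rewrite (_ : (fun _ => _) =
        fun v : 'rV[R]_(k * k) => vec_mx v i j - vec_mx v0 i j).
        move=> v; apply: (@cvgB _ _ _ _ (nbhs_filter v)); last exact: cvg_cst.
        exact: vec_mx_coord_continuous.
      by apply/funext => v; rewrite !mxE.
    have g0 : g v0 = 0.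
      by rewrite /g subrr frobenius_norm0.
    apply: (cg v0 [set y | y < e / 2]); rewrite g0.
    by apply: lt_nbhsl; rewrite divr_gt0.
  have small : \forall f \near (0 : R)^'+, f < e / 2.
    by apply: nbhs_right_lt; rewrite divr_gt0.
  exists ([set v | frobenius_norm (vec_mx v - vec_mx v0) < e / 2],
          [set f | f < e / 2]) => //.
  move=> [v f] [/= vv0e fe] [symv trv v1]; apply: lt_le_trans Pe _.
  apply: le_measure; rewrite ?inE; [exact: mS|exact: mS|move=> x /= es].
  have := @shape_score_dist _ (vec_mx v) (vec_mx v0) V theta x sV.
  rewrite trv trv0 => /(_ erefl); rewrite ler_norml => /andP[+ _].
  lra.
move=> sphere.
have [e [e0 eP]] : exists e : R, 0 < e /\ @deviatoric_sphere k `<=`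
    [set v | (a < P [set x | (e < shape_score (vec_mx v) theta V x)%R])%E].
  near (0 : R)^'+ => e; exists e; split; near: e => //.
  exact: nbhs_right_gt.
have [r r0 rP] := shape_score_continuous sV e0.
exists r; first exact: r0.
move=> V' /(rP _ (shapeMx_spd V')) VV'; have sV' := shapeMx_spd V'.
rewrite shape_depthE; apply: le_ereal_inf_tmp => _ [A A1 <-].
(* the event x = theta lies in the negligible hyperplane f = 0 *)
pose i0 := Ordinal k_gt0.
pose f (x : Rtuple R k) := tnth x i0 + - theta i0 0.
have fP : polyfun f.
  by apply: polyfun_add; [exact: polyfun_coord|exact: polyfun_cst].
have fx0 : f [tuple theta i 0 + 1 | i < k] != 0.
  by rewrite /f tnth_mktuple addrAC subrr add0r oner_eq0.
have PD : (P [set x | (0 <= shape_score (deviator A) theta V' x)%R] <=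
           P [set x | (0 <= shape_score A theta V' x)%R])%E.
  apply: (le_probability_null _ _ (measurable_polyfun_zero fP)
    (ac_polyfun_zero fP fx0)) => // x /= [s0 fx].
  rewrite -shape_score_deviator//; apply: contra_notN fx => /eqP xt.
  by rewrite /f -xt mxE subrr.
apply: le_trans PD.
(* a skew-symmetric matrix plus a scalar one has a null deviator *)
have [D0|D0] := eqVneq (frobenius_norm (deviator A)) 0.
  rewrite (_ : [set x | _] = setT).
    rewrite probability_setT; apply/ltW; apply: lt_le_trans aD _.
    by apply: le_trans (Dle _ A1) _; exact: probability_le1.
  apply/seteqP; split=> // x _ /=.
  by rewrite (frobenius_norm0_eq D0) shape_scoreE mul0mx mxtrace0 mulr0 subr0.
have {}D0 : 0 < frobenius_norm (deviator A).
  by rewrite lt_def D0 frobenius_norm_ge0.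
pose N := (frobenius_norm (deviator A))^-1 *: deviator A.
have N1 : frobenius_norm N = 1.
  by rewrite frobenius_normZ gtr0_norm ?invr_gt0// mulVf// gt_eqF.
have SN : deviatoric_sphere (mxvec N).
  split; rewrite mxvecK//.
    by rewrite /N linearZ/= deviator_tr.
  by rewrite mxtraceZ mxtrace_deviator// mulr0.
apply: ltW; apply: lt_le_trans (eP _ SN) _; rewrite /= mxvecK.
apply: le_measure; rewrite ?inE; [exact: mS|exact: mW|move=> x /= es].
have := VV' N theta x N1; rewrite ler_norml => /andP[+ _].
rewrite {1}/N shape_scoreZ => H.
rewrite -(pmulr_rge0 _ (_ : 0 < (frobenius_norm (deviator A))^-1)) ?invr_gt0//.
lra.
Unshelve. all: by end_near. Qed.

End absolutely_continuous.
End semicontinuity.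

(** * Semicontinuity and continuity *)

Lemma shape_depth_le1 (R : realType) k (theta : 'cV[R]_k) (V : 'M[R]_k)
    (P : probability (Rtuple R k) R) :
  (0 < k)%N -> (shape_depth theta V P <= 1)%E.
Proof.
move=> k0; rewrite shape_depthE.
pose i := Ordinal k0; pose A : 'M[R]_k := delta_mx i i.
apply: ge_ereal_inf; exists (P [set x | 0 <= shape_score A theta V x]).
  exists A => //=; apply/eqP.
  rewrite -(@eqrXn2 _ 2)// ?frobenius_norm_ge0// frobenius_norm_sqr trmx_delta.
  rewrite mul_delta_mx expr1n /mxtrace (bigD1 i)//= mxE eqxx big1 ?addr0//.
  by move=> j ji; rewrite mxE (negbTE ji).
apply: probability_le1; apply: measurable_superlevel.
exact: measurable_shape_score.
Qed.

Lemma shape_depth_ge0 (R : realType) k (theta : 'cV[R]_k) (V : 'M[R]_k)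
    (P : probability (Rtuple R k) R) : (0 <= shape_depth theta V P)%E.
Proof. by apply: le_ereal_inf_tmp => _ [u _ <-]; exact: measure_ge0. Qed.

Lemma upper_semicontinuousP (X : topologicalType) (R : numFieldType)
    (f : X -> \bar R) :
  upper_semicontinuous f <-> forall a, open [set x | (f x < a%:E)%E].
Proof.
split=> [uf a|openf x a fxa].
  rewrite openE => x /= /uf[U xU Ua]; exact: filterS xU.
by exists [set x | (f x < a%:E)%E] => //; apply: open_nbhs_nbhs; split.
Qed.

Lemma semicontinuous_continuous (X : topologicalType) (R : realFieldType)
    (f : X -> \bar R) : (forall x, f x \is a fin_num) ->
  upper_semicontinuous f -> lower_semicontinuous f -> continuous f.
Proof.
move=> ffin uf lf x U; have /fineK fx := ffin x.
rewrite /nbhs/= -fx => -[e/= e0 eU].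
have [V xV Vu] : exists2 V, nbhs x V &
    forall y, V y -> (f y < (fine (f x) + e)%:E)%E.
  by apply: uf; rewrite -fx lte_fin ltrDl.
have [W xW Wl] : exists2 W, nbhs x W &
    forall y, W y -> ((fine (f x) - e)%:E < f y)%E.
  by apply: lf; rewrite -[ltRHS]fx lte_fin ltrBlDr ltrDl.
apply: filterS (filterI xV xW) => y [/Vu fyu /Wl fyl].
move: fyu fyl; rewrite /= -(fineK (ffin y)) !lte_fin => fyu fyl.
apply: eU; rewrite /ball_/= ltr_distlC; apply/andP; split; lra.
Qed.

Lemma open_geodesic_open (R : realType) k (S : set (shapeMx R k)) :
  geodesic_open S -> open S.
Proof. by []. Qed.

Unset Implicit Arguments.
Theorem theorem3p1 (R : realType) (k : nat) (k_gt0 : (0 < k)%N)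
    (P : probability (Rtuple R k) R) (theta : 'cV[R]_k) :
  [/\ upper_semicontinuous (fun V : shapeMx R k => shape_depth theta V P),
      forall alpha : R, 0 <= alpha -> closed (depth_region theta alpha P) &
      P `<< lebesgue_tuple R k ->
        lower_semicontinuous (fun V : shapeMx R k => shape_depth theta V P) /\
        continuous (fun V : shapeMx R k => shape_depth theta V P)].
Proof.
have usc : upper_semicontinuous (fun V : shapeMx R k => shape_depth theta V P).
  apply/upper_semicontinuousP => a; apply: open_geodesic_open => V.
  exact: shape_depth_lt_near.
split=> [//|alpha _|P_ac].
  rewrite (_ : depth_region _ _ _ =
    ~` [set V : shapeMx R k | (shape_depth theta V P < alpha%:E)%E]).
    by apply: open_closedC; exact: (upper_semicontinuousP _).1.
  apply/seteqP; split=> V /=; rewrite /depth_region/= leNgt; first by move/negP.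
  by move=> ?; exact/negP.
have fin (V : shapeMx R k) : shape_depth theta V P \is a fin_num.
  rewrite ge0_fin_numE ?shape_depth_ge0//.
  by rewrite (le_lt_trans (shape_depth_le1 _ _ _ k_gt0))// ltry.
have lsc : lower_semicontinuous (fun V : shapeMx R k => shape_depth theta V P).
  apply/lower_semicontinuousP => a; apply: open_geodesic_open => V /=.
  rewrite -(fineK (fin V)) lte_fin => aV.
  (* an intermediate level, as only a non-strict lower bound is available *)
  pose b := (a + fine (shape_depth theta V P)) / 2.
  have [|r r0 rP] := @shape_depth_gt_near _ _ theta P k_gt0 P_ac V b%:E.
    by rewrite -(fineK (fin V)) lte_fin /b; lra.
  exists r; first exact: r0.
  move=> V' /rP; apply: lt_le_trans.
  by rewrite lte_fin /b; lra.
by split=> //; exact: semicontinuous_continuous.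
Qed.
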